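(* For any value $\kappa\ge 1$, there exists a positive definite matrix $M$ with condition number $\kappa$ such that, for any step size $\eta>0$, there exists an initialization $U_0$ (a positive definite matrix) that has the same eigenvectors as $M$, with $\|U_0\|_2\le\sqrt{3\|M\|_2}$ and $\sigma_{\min}(U_0)\ge\frac{1}{10}\sqrt{\sigma_{\min}(M)}$, such that the iterates $U_{t+1}=U_t-\eta(U_t^2-M)U_t-\eta U_t(U_t^2-M)$, $t\ge0$, satisfy $$\|U_t^2-M\|_F\ge\frac14\sigma_{\min}(M)\qquad\text{for all } t\le\kappa.$$
   Context: Positive definite means symmetric positive definite (real). $\|\cdot\|_2$ is the operator (spectral) norm, $\|\cdot\|_F$ the Frobenius norm, $\sigma_{\min}(\cdot)$ the smallest singular value. The condition number of $M$ is $\|M\|_2/\sigma_{\min}(M)$. The dimension of $M$ may be chosen. *)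

(* Defs.v *)
From mathcomp Require Import all_boot all_order all_algebra.
From mathcomp Require Import classical_sets reals.

Set Implicit Arguments.
Unset Strict Implicit.
Unset Printing Implicit Defensive.

Import Order.TTheory GRing.Theory Num.Theory.

Local Open Scope classical_set_scope.
Local Open Scope ring_scope.

Definition posdefmx (R : realType) (n : nat) (A : 'M[R]_n) : Prop :=
  A^T = A /\ forall x : 'cV[R]_n, x != 0 -> 0 < (x^T *m A *m x) 0 0.

Definition euclid_norm (R : realType) (n : nat) (x : 'cV[R]_n) : R :=
  Num.sqrt (\sum_i x i 0 ^+ 2).

Definition frob_norm (R : realType) (m n : nat) (A : 'M[R]_(m, n)) : R :=
  Num.sqrt (\sum_i \sum_j A i j ^+ 2).

Definition op_norm (R : realType) (m n : nat) (A : 'M[R]_(m, n)) : R :=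
  sup [set euclid_norm (A *m x) | x in [set x | euclid_norm x <= 1]].

Definition singular_value (R : realType) (n : nat) (A : 'M[R]_n) (s : R) :
  Prop := 0 <= s /\ eigenvalue (A^T *m A) (s ^+ 2).

(* For n > 0 the set of singular values is finite and nonempty, so this
   infimum is a minimum. *)
Definition sigma_min (R : realType) (n : nat) (A : 'M[R]_n) : R :=
  inf [set s | singular_value A s].

Definition cond_number (R : realType) (n : nat) (A : 'M[R]_n) : R :=
  op_norm A / sigma_min A.

(* [eigenvalue] and [eigenspace] act on row vectors; this is the usual
   column-vector notion. *)
Definition eigenvector (R : realType) (n : nat) (A : 'M[R]_n) (v : 'cV[R]_n) :
  Prop := v != 0 /\ exists a : R, A *m v = a *: v.

Definition same_eigenvectors (R : realType) (n : nat) (A B : 'M[R]_n) : Prop :=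
  forall v : 'cV[R]_n, eigenvector A v <-> eigenvector B v.

Definition gd_step (R : realType) (n : nat) (M : 'M[R]_n) (eta : R)
    (U : 'M[R]_n) : 'M[R]_n :=
  U - eta *: ((U *m U - M) *m U) - eta *: (U *m (U *m U - M)).

Definition gd_iterate (R : realType) (n : nat) (M : 'M[R]_n) (eta : R)
    (U0 : 'M[R]_n) (t : nat) : 'M[R]_n :=
  iter t (gd_step M eta) U0.

(* Main.v *)
Require Import Defs.
From mathcomp Require Import all_boot all_order all_algebra.
From mathcomp Require Import reals.
From mathcomp Require Import classical_sets ring lra.

Set Implicit Arguments.
Unset Strict Implicit.

Import Order.TTheory GRing.Theory Num.Theory.

Local Open Scope ring_scope.

(** Take [M = diag(kappa, 1)] and [U0 = s sqrt(M)]; gradient descent then acts on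
    each eigenvalue by [u |-> u (1 + 2 eta (m - u^2))].  If [2 eta kappa >= 1],
    the choice [s = sqrt 3] makes the step too long for the top eigenvalue: the
    factor is at most [-1] as soon as [u^2 >= 3 kappa], so [u^2] never goes
    below [3 kappa].  If [2 eta kappa < 1], the choice [s = 1/10] makes the step
    too short for the bottom eigenvalue, which after [t <= kappa] steps is at
    most [(1 + 2 eta)^t / 10 <= 3/10]. *)

(** * Norms, singular values and eigenvectors of diagonal matrices *)

Lemma euclid_norm_delta (R : realType) n (i : 'I_n) (a : R) : 0 <= a ->
  euclid_norm (a *: delta_mx i 0 : 'cV[R]_n) = a.
Proof.
move=> a0; rewrite /euclid_norm (bigD1 i) //= big1 ?addr0.
  by rewrite !mxE !eqxx mulr1 sqrtr_sqr ger0_norm.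
by move=> j ji; rewrite !mxE (negPf ji) mulr0 expr0n.
Qed.

Lemma mul_diag_delta (R : realType) n (d : 'rV[R]_n) (i : 'I_n) :
  diag_mx d *m delta_mx i 0 = d 0 i *: delta_mx i 0 :> 'cV[R]_n.
Proof.
apply/matrixP => j k; rewrite mul_diag_mx !mxE.
by case: eqP => [->//|_]; rewrite !mulr0.
Qed.

Lemma op_norm_diag (R : realType) n (d : 'rV[R]_n) (i : 'I_n) :
  (forall j, 0 <= d 0 j <= d 0 i) -> op_norm (diag_mx d) = d 0 i.
Proof.
move=> hd; have di0 : 0 <= d 0 i by case/andP: (hd i).
have ub : ubound [set euclid_norm (diag_mx d *m x) |
                  x in [set x : 'cV[R]_n | euclid_norm x <= 1]]%classic (d 0 i).
  move=> _ [x /= x1 <-].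
  apply: (@le_trans _ _ (d 0 i * euclid_norm x)); last first.
    by rewrite -[leRHS]mulr1 ler_wpM2l.
  rewrite -[X in X * _](ger0_norm di0) -sqrtr_sqr -sqrtrM ?sqr_ge0 //.
  rewrite ler_wsqrtr // mulr_sumr ler_sum // => j _.
  rewrite mul_diag_mx !mxE exprMn ler_wpM2r ?sqr_ge0 //.
  by case/andP: (hd j) => dj0 dji; rewrite lerXn2r ?nnegrE.
have mem : [set euclid_norm (diag_mx d *m x) |
            x in [set x : 'cV[R]_n | euclid_norm x <= 1]]%classic (d 0 i).
  exists (delta_mx i 0); last by rewrite mul_diag_delta euclid_norm_delta.
  by rewrite /= -[delta_mx i 0]scale1r euclid_norm_delta.
apply/le_anti/andP; split; first by apply: ge_sup ub; exists (d 0 i).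
by apply: ub_le_sup mem; exists (d 0 i).
Qed.

Lemma sigma_min_diag (R : realType) n (d : 'rV[R]_n) (i : 'I_n) :
  (forall j, 0 <= d 0 i <= d 0 j) -> sigma_min (diag_mx d) = d 0 i.
Proof.
move=> hd; have di0 : 0 <= d 0 i by case/andP: (hd i).
have sqE : (diag_mx d)^T *m diag_mx d = diag_mx (\row_j (d 0 j * d 0 j)).
  by rewrite tr_diag_mx mulmx_diag.
have lb : lbound [set s | singular_value (diag_mx d) s]%classic (d 0 i).
  (* At a coordinate [j] where the eigenvector [v] does not vanish, the eigenvalue equation gives
     [s ^+ 2 = d_j ^+ 2], hence [s = d_j] by nonnegativity. *)
  move=> s [s0]; rewrite sqE => /eigenvalueP[v /rowP vE /rV0Pn[j vj]].
  have := vE j; rewrite mul_mx_diag !mxE mulrC => /(mulIf vj) dE.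
  case/andP: (hd j) => _ /le_trans; apply.
  have dj0 : 0 <= d 0 j by case/andP: (hd j) => h1 h2; exact: le_trans h2.
  by rewrite -(@ler_pXn2r _ 2) ?nnegrE // -dE expr2.
have mem : [set s | singular_value (diag_mx d) s]%classic (d 0 i).
  split=> //; rewrite sqE; apply/eigenvalueP; exists (delta_mx 0 i).
    apply/rowP => j; rewrite mul_mx_diag !mxE /= expr2.
    by case: eqP => [->|_]; rewrite ?mul0r ?mulr0 // mul1r mulr1.
  by apply/rV0Pn; exists i; rewrite mxE !eqxx oner_eq0.
apply/le_anti/andP; split; last by apply: lb_le_inf lb; exists (d 0 i).
by apply: ge_inf mem; exists (d 0 i).
Qed.

Lemma posdefmx_diag (R : realType) n (d : 'rV[R]_n) :
  (forall j, 0 < d 0 j) -> posdefmx (diag_mx d).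
Proof.
move=> d0; split=> [|x /cV0Pn[i xi]]; first exact: tr_diag_mx.
have sqE j : (x^T *m diag_mx d) 0 j * x j 0 = d 0 j * x j 0 ^+ 2.
  by rewrite mul_mx_diag !mxE; ring.
rewrite mxE (eq_bigr _ (fun j _ => sqE j)) (bigD1 i) //= ltr_pwDl //.
  by rewrite mulr_gt0 // exprn_even_gt0.
by rewrite sumr_ge0 // => j _; rewrite mulr_ge0 ?sqr_ge0 // ltW.
Qed.

(** The support of an eigenvector lies in a single level set of [d]. The hypothesis makes [e]
    constant there, so any support index [k] supplies the new eigenvalue. *)
Lemma eigenvector_diag (R : realType) n (d e : 'rV[R]_n) (v : 'cV[R]_n) :
  (forall i j, d 0 i = d 0 j -> e 0 i = e 0 j) ->
  eigenvector (diag_mx d) v -> eigenvector (diag_mx e) v.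
Proof.
move=> de [v0 [a /colP va]]; split=> //; have /cV0Pn[k vk] := v0.
have dE i : v i 0 != 0 -> d 0 i = a.
  by move=> vi; have := va i; rewrite mul_diag_mx !mxE => /(mulIf vi).
exists (e 0 k); apply/colP => i; rewrite mul_diag_mx !mxE.
have [->|vi] := eqVneq (v i 0) 0; first by rewrite !mulr0.
by rewrite (de i k) // !dE.
Qed.

(** * Gradient descent on a single eigenvalue *)

Definition gd_eigen (R : realType) (m eta u : R) : R :=
  u * (1 + 2 * eta * (m - u ^+ 2)).

(** Diagonal matrices commute, so the two correction terms of [gd_step] coincide; hence the factor 2
    in [gd_eigen]. *)
Lemma gd_iterate_diag (R : realType) n (d u : 'rV[R]_n) (eta : R) t :
  gd_iterate (diag_mx d) eta (diag_mx u) t =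
  diag_mx (\row_j iter t (gd_eigen (d 0 j) eta) (u 0 j)).
Proof.
elim: t => [|t IH].
  by congr diag_mx; apply/rowP => j; rewrite mxE.
rewrite /gd_iterate iterS -/(gd_iterate _ _ _ t) IH /gd_step.
rewrite mulmx_diag -raddfB /= !mulmx_diag -!linearZ /= -!raddfB /=.
by congr diag_mx; apply/rowP => j; rewrite !mxE /= /gd_eigen; ring.
Qed.

(** Reduces the lower bound on the error to one badly behaved eigenvalue. *)
Lemma ler_norm_frob (R : realType) m n (A : 'M[R]_(m, n)) i j :
  `|A i j| <= frob_norm A.
Proof.
rewrite -sqrtr_sqr ler_wsqrtr // (bigD1 i) //= (bigD1 j) //= -addrA lerDl.
apply: addr_ge0; apply: sumr_ge0 => k _; first exact: sqr_ge0.
by apply: sumr_ge0 => l _; exact: sqr_ge0.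
Qed.

Lemma gd_eigen_overshoot (R : realType) (m eta u : R) t :
  0 <= m -> 0 <= eta -> 1 <= 2 * eta * m -> 3 * m <= u ^+ 2 ->
  3 * m <= iter t (gd_eigen m eta) u ^+ 2.
Proof.
move=> m0 eta0 hm hu; elim: t => [//|t /=]; set w := iter _ _ _ => hw.
apply: (le_trans hw); rewrite /gd_eigen exprMn -[leLHS]mulr1.
rewrite ler_wpM2l ?sqr_ge0 //.
(* Here [m - w ^+ 2 <= - 2 m], so [f <= 1 - 4 eta m <= -1]. *)
set f := 1 + _; suff : f <= -1 by move=> f1; rewrite expr2; nra.
rewrite /f; nra.
Qed.

(** A polynomial substitute for [(1 + x)^t <= exp (t x)]; for [t x <= 1] the right-hand side is at
    most 3. *)
Lemma exp1D_le (R : realType) (x : R) t : 0 <= x -> t%:R * x <= 1 ->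
  (1 + x) ^+ t <= 1 + t%:R * x + (t%:R * x) ^+ 2.
Proof.
move=> x0; elim: t => [|t IH] tx; first by rewrite expr0 mul0r expr0n /=; lra.
have t0 : 0 <= t%:R :> R by rewrite ler0n.
move: tx; rewrite -natr1 => tx.
have tx1 : t%:R * x <= 1 by lra.
rewrite exprSr.
apply: le_trans (_ : (1 + t%:R * x + (t%:R * x) ^+ 2) * (1 + x) <= _).
  by rewrite ler_wpM2r ?IH //; lra.
(* The two sides of the goal differ by exactly this product plus [x ^+ 2]. *)
have : 0 <= (t%:R * x ^+ 2) * (1 - t%:R * x).
  by rewrite mulr_ge0 ?mulr_ge0 ?sqr_ge0 // subr_ge0.
have := sqr_ge0 x; move: (t%:R) => a; nra.
Qed.

Lemma gd_eigen_slow (R : realType) (eta : R) t :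
  0 <= eta -> 2 * eta * t%:R <= 1 ->
  0 <= iter t (gd_eigen 1 eta) (10^-1) <= 10^-1 * (1 + 2 * eta) ^+ t.
Proof.
move=> eta0; elim: t => [|t IH] te.
  by rewrite /= expr0 mulr1 lexx andbT invr_ge0.
have t0 : 0 <= t%:R :> R by rewrite ler0n.
have te' : 2 * eta * t%:R <= 1 by move: te; rewrite -natr1; nra.
have /andP[] := IH te'; rewrite iterS; set w := iter _ _ _ => w0 wle.
have eta20 : 0 <= 2 * eta by lra.
have := @exp1D_le _ (2 * eta) t eta20; rewrite mulrC => /(_ te') he.
(* The growth bound gives [w <= 3/10]. Knowing [w <= 1] is enough to place the next factor between 1
   and [1 + 2 * eta], which preserves both bounds. *)
have w1 : w <= 1.
  have : 0 <= 2 * eta * t%:R by rewrite mulr_ge0.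
  by move: he; set y := 2 * eta * _ in te' * => he y0; nra.
have w21 : w ^+ 2 <= 1 by rewrite expr_le1.
rewrite /gd_eigen [_ ^+ t.+1]exprSr mulrA; apply/andP; split.
  by rewrite mulr_ge0 // addr_ge0 // mulr_ge0 // subr_ge0.
apply: le_trans (_ : w * (1 + 2 * eta) <= _).
  by rewrite ler_wpM2l // lerD2l ler_piMr //; have := sqr_ge0 w; lra.
by rewrite ler_wpM2r //; lra.
Qed.

Lemma gd_eigen_slow_sqr (R : realType) (eta : R) t :
  0 <= eta -> 2 * eta * t%:R <= 1 ->
  iter t (gd_eigen 1 eta) (10^-1) ^+ 2 <= 4^-1.
Proof.
move=> eta0 te; have /andP[w0 wle] := gd_eigen_slow eta0 te.
have eta20 : 0 <= 2 * eta by lra.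
have := @exp1D_le _ (2 * eta) t eta20; rewrite mulrC => /(_ te) he.
have y0 : 0 <= 2 * eta * t%:R by rewrite mulr_ge0.
have y2 : (2 * eta * t%:R) ^+ 2 <= 1 by rewrite expr_le1.
have : iter t (gd_eigen 1 eta) (10^-1) <= 3 / 10 by lra.
move: w0; set w := iter _ _ _ => w0 w3; nra.
Qed.

Theorem theorem3p5 (R : realType) (kappa : R) (hkappa : 1 <= kappa) :
  exists (n : nat) (M : 'M[R]_n.+1),
    posdefmx M /\
    cond_number M = kappa /\
    forall eta : R, 0 < eta ->
      exists U0 : 'M[R]_n.+1,
        posdefmx U0 /\
        same_eigenvectors U0 M /\
        op_norm U0 <= Num.sqrt (3 * op_norm M) /\
        10^-1 * Num.sqrt (sigma_min M) <= sigma_min U0 /\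
        forall t : nat, t%:R <= kappa ->
          4^-1 * sigma_min M
            <= frob_norm (let Ut := gd_iterate M eta U0 t in Ut *m Ut - M).
Proof.
have k0 : 0 <= kappa by apply: le_trans hkappa.
have sk0 : 0 <= Num.sqrt kappa by exact: sqrtr_ge0.
pose d : 'rV[R]_2 := \row_i (if i == 0 then kappa else 1).
pose e (s : R) : 'rV[R]_2 := \row_i (s * Num.sqrt (d 0 i)).
have d0 : d 0 0 = kappa by rewrite mxE.
have d1 : d 0 1 = 1 by rewrite mxE.
have dP j : 1 <= d 0 j <= kappa by rewrite mxE; case: ifP; rewrite lexx hkappa.
have opM : op_norm (diag_mx d) = kappa.
  rewrite (@op_norm_diag _ _ _ 0) d0 // => j; have /andP[h ->] := dP j.
  by rewrite (le_trans _ h).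
have sgM : sigma_min (diag_mx d) = 1.
  rewrite (@sigma_min_diag _ _ _ 1) d1 // => j.
  by have /andP[-> _] := dP j; rewrite ler01.
(* The size is [n.+1], so this is a 2 by 2 matrix: index 0 carries [kappa], index 1 carries 1. *)
exists 1%N, (diag_mx d); split; [|split].
- by apply: posdefmx_diag => j; have /andP[h _] := dP j; exact: lt_le_trans h.
- by rewrite /cond_number opM sgM divr1.
move=> eta eta0; rewrite opM sgM sqrtr1 !mulr1.
(* The upper limit on [s] comes from the norm bound, the lower one from the singular value bound;
   the two regimes use the two endpoints. *)
have init (s : R) : 10^-1 <= s <= Num.sqrt 3 -> posdefmx (diag_mx (e s)) /\
    same_eigenvectors (diag_mx (e s)) (diag_mx d) /\
    op_norm (diag_mx (e s)) <= Num.sqrt (3 * kappa) /\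
    10^-1 <= sigma_min (diag_mx (e s)).
  move=> /andP[s10 s3]; have s0 : 0 < s by apply: lt_le_trans s10; rewrite invr_gt0.
  have eP j : s <= e s 0 j <= s * Num.sqrt kappa.
    have /andP[h1 h2] := dP j; rewrite [e s 0 j]mxE; apply/andP; split; last first.
      by rewrite ler_wpM2l ?(ltW s0) // ler_wsqrtr.
    by rewrite -[leLHS]mulr1 ler_wpM2l ?(ltW s0) // -sqrtr1 ler_wsqrtr.
  have e0 : e s 0 0 = s * Num.sqrt kappa by rewrite [LHS]mxE d0.
  have e1 : e s 0 1 = s by rewrite [LHS]mxE d1 sqrtr1 mulr1.
  split; [|split; [|split]].
  - by apply: posdefmx_diag => j; have /andP[h _] := eP j; exact: lt_le_trans h.
  (* Scaling by [s > 0] and the square root are injective on nonnegative reals, so [e s] and [d]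
     have the same coincidences among their entries. *)
  - move=> v; split; apply: eigenvector_diag => i j;
      rewrite [e s 0 i]mxE [e s 0 j]mxE.
      move=> /(mulfI (lt0r_neq0 s0)) /eqP; rewrite eqr_sqrt => [/eqP//||].
        by have /andP[h _] := dP i; exact: le_trans h.
      by have /andP[h _] := dP j; exact: le_trans h.
    by move=> ->.
  - rewrite (@op_norm_diag _ _ _ 0) e0; last first.
      by move=> j; have /andP[h ->] := eP j; rewrite (le_trans (ltW s0) h).
    by rewrite sqrtrM // ler_wpM2r.
  - rewrite (@sigma_min_diag _ _ _ 1) e1 // => j.
    by have /andP[-> _] := eP j; rewrite ltW.
have entry (s : R) t (i : 'I_2) :
    `|iter t (gd_eigen (d 0 i) eta) (e s 0 i) ^+ 2 - d 0 i| <=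
    frob_norm (let Ut := gd_iterate (diag_mx d) eta (diag_mx (e s)) t in
               Ut *m Ut - diag_mx d).
  apply: le_trans (ler_norm_frob _ i i).
  by cbv zeta; rewrite gd_iterate_diag mulmx_diag -raddfB /= !mxE eqxx mulr1n expr2.
have [big|small] := lerP 1 (2 * eta * kappa).
  exists (diag_mx (e (Num.sqrt 3))).
  have [|? [? [? ?]]] := init (Num.sqrt 3).
    rewrite lexx andbT; apply: le_trans (_ : 1 <= _).
      by rewrite invf_le1 ?ler1n.
    by rewrite -[leLHS]sqrtr1 ler_wsqrtr // ler1n.
  do 4!split => //; move=> t _; apply: le_trans (entry _ t 0).
  rewrite d0; have := @gd_eigen_overshoot _ kappa eta
    (e (Num.sqrt 3) 0 0) t k0 (ltW eta0) big.
  rewrite mxE d0 exprMn !sqr_sqrtr // => /(_ (lexx _)).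
  (* The top eigenvalue starts exactly at [u ^+ 2 = 3 kappa], so the error stays at least
     [2 kappa >= 2], for every [t]. *)
  set w := _ ^+ 2 => hw; rewrite ger0_norm; lra.
exists (diag_mx (e 10^-1)).
have [|? [? [? ?]]] := init 10^-1.
  rewrite lexx /=; apply: le_trans (_ : 1 <= _); first by rewrite invf_le1 ?ler1n.
  by rewrite -[leLHS]sqrtr1 ler_wsqrtr // ler1n.
do 4!split => //; move=> t tk; apply: le_trans (entry _ t 1).
rewrite d1 mxE d1 sqrtr1 mulr1.
(* The time limit [t <= kappa] turns the small step size into the hypothesis of the slow growth
   bound; the error is then at least [3/4]. *)
have te : 2 * eta * t%:R <= 1.
  by apply: le_trans (ltW small); rewrite ler_wpM2l //; lra.
have := gd_eigen_slow_sqr (ltW eta0) te; set w := _ ^+ 2 => hw.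
rewrite ler0_norm; lra.
Qed.
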